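(* Let $(W,S)$ be a right-angled Coxeter system of type $\Gamma$. The set $[S]_c$ is the set of (finite) sums $\sum_{N\in\mathcal N}X_N$ where $X_N\in[N]$ for every $N\in\mathcal N$ and where $\{N\in\mathcal N\mid X_N\neq\emptyset\}$ is finite and has commutative union (i.e. consists of kernels that are pairwise in relation $R_{\mathcal P}$). Consequently $$K(\Gamma)=\{\varphi\in\mathrm{Aut}([S])\mid\forall T\in\mathcal C,\ \varphi([T])=[T]\}.$$
   Context: $(W,S)$ is a right-angled Coxeter system (arbitrary rank): $W$ is generated by the set $S$ of elements of order $2$, with $m_{s,t}\in\{1,2,\infty\}$ the order of $st$, and $W=\langle S\mid (st)^{m_{s,t}}=1,\ m_{s,t}\ne\infty\rangle$; $\Gamma=(m_{s,t})_{s,t\in S}$. For $X\subseteq S$, $C(X)=\{y\in S\mid\forall x\in X,\ xy=yx\}$, $C^2=C\circ C$, $C^2(s)=C^2(\{s\})$. A subset of $S$ is commutative if its elements pairwise commute. $\mathcal C=\{C^2(s)\mid s\in S\}$ is the set of cells. Kernels are the equivalence classes on $S$ for $C^2(s)=C^2(t)$; $\mathcal N$ is the set of kernels (a partition of $S$); for $N\in\mathcal N$, $\mathrm{Cel}(N)=C^2(s)$ for any $s\in N$. For $X,Y\subseteq S$, $XR_{\mathcal P}Y$ means every element of $X$ commutes with every element of $Y$. $[S]$ is the $\mathbb F_2$-vector space of finite subsets of $S$ (addition is symmetric difference), $[T]$ the subspace of finite subsets of $T\subseteq S$, so that $[S]=\bigoplus_{N\in\mathcal N}[N]$; $[S]_c$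 is the set of commutative finite subsets of $S$. $\mathrm{Aut}([S])$ is the group of linear automorphisms of $[S]$ and $\mathrm{Aut}([S],[S]_c)$ its subgroup of $\varphi$ with $\varphi([S]_c)=[S]_c$. Every $\varphi\in\mathrm{Aut}([S],[S]_c)$ induces a permutation $\varphi_{\mathcal N}$ of $\mathcal N$, where $\varphi_{\mathcal N}(N)=N'$ is the kernel with $\varphi([\mathrm{Cel}(N)])=[\mathrm{Cel}(N')]$. $K(\Gamma)$ is the kernel of the group homomorphism $\varphi\mapsto\varphi_{\mathcal N}$ on $\mathrm{Aut}([S],[S]_c)$; that is, $K(\Gamma)$ consists of the $\varphi\in\mathrm{Aut}([S],[S]_c)$ with $\varphi([T])=[T]$ for every cell $T$. *)

(* Defs.v *)
From HB Require Import structures.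
From mathcomp Require Import all_boot all_order all_algebra.
From mathcomp Require Import finmap.
From mathcomp Require Import boolp classical_sets functions cardinality fsbigop.

Set Implicit Arguments.
Unset Strict Implicit.
Unset Printing Implicit Defensive.

Import GRing.Theory.

Local Open Scope classical_set_scope.
Local Open Scope ring_scope.

(* An alias of {fset K}, so that the vector space structure below is not
   attached to {fset K} itself. *)
Definition fpow (K : choiceType) : Type := {fset K}.

HB.instance Definition _ (K : choiceType) := Choice.on (fpow K).

Section FpowLmodule.
Variable K : choiceType.
Implicit Types (X Y Z : fpow K) (a b : 'F_2).

Definition fpow_in (x : K) X : bool := x \in (X : {fset K}).

Definition symdiff X Y : fpow K := ((X `\` Y) `|` (Y `\` X))%fset.

Lemma fpow_inD x X Y : fpow_in x (symdiff X Y) = fpow_in x X (+) fpow_in x Y.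
Proof.
rewrite /fpow_in /symdiff in_fsetU !in_fsetD.
by case: (x \in _); case: (x \in _).
Qed.

Lemma fpowP X Y : (forall x, fpow_in x X = fpow_in x Y) -> X = Y.
Proof. by move=> XY; apply/fsetP. Qed.

Lemma symdiffA : associative symdiff.
Proof. by move=> X Y Z; apply: fpowP => x; rewrite !fpow_inD addbA. Qed.

Lemma symdiffC : commutative symdiff.
Proof. by move=> X Y; apply: fpowP => x; rewrite !fpow_inD addbC. Qed.

Lemma symdiff0X : left_id (fset0 : fpow K) symdiff.
Proof. by move=> X; apply: fpowP => x; rewrite fpow_inD /fpow_in in_fset0. Qed.

Lemma symdiffXX : left_inverse (fset0 : fpow K) id symdiff.
Proof.
by move=> X; apply: fpowP => x; rewrite fpow_inD addbb /fpow_in in_fset0.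
Qed.

HB.instance Definition _ :=
  GRing.isZmodule.Build (fpow K) symdiffA symdiffC symdiff0X symdiffXX.

Definition fpow_scale a X : fpow K := if a == 0 then 0 else X.

Let F2_cases a : a = 0 \/ a = 1.
Proof. by case: a => [[|[|//]] ?]; [left|right]; apply: val_inj. Qed.

Fact fpow_scaleA a b X : fpow_scale a (fpow_scale b X) = fpow_scale (a * b) X.
Proof. by rewrite /fpow_scale mulf_eq0; case: eqP => //= _; case: eqP. Qed.

Fact fpow_scale1 : left_id 1 fpow_scale.
Proof. by move=> X; rewrite /fpow_scale oner_eq0. Qed.

Fact fpow_scaleDr : right_distributive fpow_scale +%R.
Proof. by move=> a X Y; rewrite /fpow_scale; case: eqP; rewrite ?addr0. Qed.

Fact fpow_scaleDl X : {morph fpow_scale^~ X : a b / a + b}.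
Proof.
move=> a b; have XX : X + X = 0 by exact: symdiffXX.
by case: (F2_cases a) => ->; case: (F2_cases b) => ->;
  rewrite /fpow_scale ?addr0 ?add0r ?eqxx ?oner_eq0 ?addr0 ?add0r ?XX.
Qed.

HB.instance Definition _ := GRing.Zmodule_isLmodule.Build 'F_2 (fpow K)
  fpow_scaleA fpow_scale1 fpow_scaleDr fpow_scaleDl.

End FpowLmodule.

(* [has_order g 0] says that [g] has infinite order. *)
Definition has_order (W : groupType) (g : W) (n : nat) : Prop :=
  forall k : nat, (g ^+ k)%g = 1%g <-> (n %| k)%N.

(* The entries of [m] are the orders m_{s,t}, with 0 encoding infinity.  The
   clause [racs_pres] is the universal property of the group presented by the
   generators S and the relations (st)^{m_{s,t}} = 1, m_{s,t} finite; the
   involutions s^2 = 1 are the relations with s = t, since then m_{s,s} = 1.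
   Uniqueness of [h] follows from [racs_gen]. *)
Record right_angled_coxeter (W : groupType) (S : set W) (m : S -> S -> nat) :
    Prop := {
  racs_gen : forall w : W, exists u : seq S, w = (\prod_(s <- u) val s)%g;
  racs_invol : forall s : S, has_order (val s) 2;
  racs_order : forall s t : S, has_order (val s * val t)%g (m s t);
  racs_right_angled : forall s t : S, m s t \in [:: 1; 2; 0]%N;
  racs_pres : forall (G : groupType) (f : S -> G),
    (forall s t : S, m s t <> 0%N -> ((f s * f t) ^+ m s t)%g = 1%g) ->
    exists h : {multiplicative W -> G}, forall s : S, h (val s) = f s
}.

Section Cells.
Variables (W : groupType) (S : set W).
Implicit Types (X Y T N : set S) (s t : S).

Definition commuting (s t : S) : Prop := commute (val s) (val t).

Definition Cent X : set S := [set y | forall x, X x -> commuting x y].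

Definition C2 X : set S := Cent (Cent X).

Definition RP X Y : Prop := forall x y, X x -> Y y -> commuting x y.

Definition commutative_set X : Prop := forall x y, X x -> X y -> commuting x y.

Definition cells : set (set S) := [set C2 [set s] | s in [set: S]].

Definition kernel_of (s : S) : set S := [set t | C2 [set s] = C2 [set t]].

Definition kernels : set (set S) := [set kernel_of s | s in [set: S]].

(* All the sets in this union are equal when [N] is a kernel. *)
Definition Cel N : set S := \bigcup_(s in N) C2 [set s].

Lemma Cel_kernel N s : kernels N -> N s -> Cel N = C2 [set s].
Proof.
case=> r _ <- rs; apply/seteqP; split=> [x [t rt]|x sx]; last by exists s.
by rewrite -[C2 [set t]]rt rs.
Qed.

Lemma commutative_bigcupP (M : set (set S)) :
  commutative_set (\bigcup_(N in M) N) <->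
  (forall N N', M N -> M N' -> RP N N').
Proof.
split=> [cM N N' MN MN' x y Nx N'y|cM x y [N MN Nx] [N' MN' N'y]].
  by apply: cM; [exists N|exists N'].
exact: cM MN MN' _ _ Nx N'y.
Qed.

(* The subspace of the finite subsets of [T], inside the space [fpow S]. *)
Definition fin_subsets (T : set S) : set (fpow S) :=
  [set X | [set x | fpow_in x X] `<=` T].

Definition fin_commutative : set (fpow S) :=
  [set X | commutative_set [set x | fpow_in x X]].

Definition Aut : set {linear fpow S -> fpow S} :=
  [set phi | bijective phi].

Definition Autc : set {linear fpow S -> fpow S} :=
  [set phi | Aut phi /\ phi @` fin_commutative = fin_commutative].

(* The default value [set0], taken when there is no such kernel, is not a
   kernel. *)
Definition perm_kernels (phi : fpow S -> fpow S) (N : set S) : set S :=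
  xget set0 [set N' | kernels N' /\
                      phi @` fin_subsets (Cel N) = fin_subsets (Cel N')].

(* The kernel of [phi |-> perm_kernels phi]. *)
Definition KGamma : set {linear fpow S -> fpow S} :=
  [set phi | Autc phi /\ forall N, kernels N -> perm_kernels phi N = N].

End Cells.

Arguments cells {W} S.
Arguments kernels {W} S.
Arguments fin_commutative {W} S.
Arguments Aut {W} S.
Arguments Autc {W} S.
Arguments KGamma {W} S.

(* Main.v *)
(* Commutation of [x] and [x'] spreads to [C2 x] and [C2 x'].  Hence the kernels
   met by a commutative set have commutative union, and a linear map sending
   each [{x}] into [[C2 x]] preserves commutativity. *)
Require Import Defs.
From mathcomp Require Import all_boot all_order all_algebra.
From mathcomp Require Import finmap.
From mathcomp Require Import boolp classical_sets functions cardinality fsbigop.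

Set Implicit Arguments.
Unset Strict Implicit.
Unset Printing Implicit Defensive.

Import GRing.Theory.

Local Open Scope classical_set_scope.
Local Open Scope ring_scope.

(** * Coordinates and singletons in the space of finite subsets *)

Section Fpow.
Variable K : choiceType.
Implicit Types X Y : fpow K.

Lemma fpow_in0 (x : K) : fpow_in x 0 = false.
Proof. by rewrite /fpow_in in_fset0. Qed.

Lemma fpow_in_add (x : K) X Y : fpow_in x (X + Y) = fpow_in x X (+) fpow_in x Y.
Proof. exact: fpow_inD. Qed.

Lemma fpow_in_sum (I : Type) (r : seq I) (P : pred I) (F : I -> fpow K) (x : K) :
  fpow_in x (\sum_(i <- r | P i) F i) =
  \big[addb/false]_(i <- r | P i) fpow_in x (F i).
Proof. exact: (big_morph _ (fpow_in_add x) (fpow_in0 x)). Qed.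

Lemma fpow_in_sum_exists (I : eqType) (r : seq I) (F : I -> fpow K) (x : K) :
  fpow_in x (\sum_(i <- r) F i) -> exists2 i, i \in r & fpow_in x (F i).
Proof.
rewrite big_seq fpow_in_sum => xF; apply: contrapT => noi.
move: xF; rewrite big1 // => i ir; apply/negP => xi; apply: noi; by exists i.
Qed.

Lemma fpow_in_fset1 (x y : K) : fpow_in x ([fset y]%fset : fpow K) = (x == y).
Proof. by rewrite /fpow_in in_fset1. Qed.

(** Singletons span the space, so a linear map can be evaluated on a finite subset one element at a
    time. *)
Lemma fpow_sum_singletons X :
  X = \sum_(x <- (X : {fset K})) ([fset x]%fset : fpow K).
Proof.
apply: fpowP => x; rewrite fpow_in_sum.
under eq_bigr do rewrite fpow_in_fset1.
have [xX|xX] := boolP (fpow_in x X).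
  rewrite (bigD1_seq x) //= eqxx big1 // => y; by rewrite eq_sym => /negbTE.
rewrite big_seq big1 // => y yX; apply/negbTE; apply: contraNneq xX => -> //.
Qed.

(** Supplies the component of [X] along [T], used below with [T] a kernel. *)
Lemma fpow_restrict_exists X (T : set K) :
  exists Y, forall x, fpow_in x Y = fpow_in x X && (x \in T).
Proof.
exists ([fset x in (X : {fset K}) | x \in T]%fset : fpow K) => x.
by rewrite /fpow_in !inE.
Qed.

End Fpow.

(** * Commutation, kernels and the decomposition along kernels *)

Section Cells.
Variables (W : groupType) (S : set W).
Implicit Types (X Y T N : set S) (s t x y : S).

Lemma commuting_sym s t : commuting s t -> commuting t s.
Proof. by move=> st; apply: esym. Qed.

(** Since [t] centralizes [s], it commutes with [x]; so [x] centralizes [t] and therefore commutes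
    with [y]. *)
Lemma commuting_C2 s t x y : commuting s t ->
  C2 [set s] x -> C2 [set t] y -> commuting x y.
Proof.
by move=> st sx ty; apply: ty => _ ->; apply: sx => _ ->.
Qed.

Lemma C2_self s : C2 [set s] s.
Proof. by move=> y; move/(_ s erefl)/commuting_sym. Qed.

Lemma kernels_kernel_of s : kernels S (kernel_of s).
Proof. by exists s. Qed.

Lemma kernel_of_self s : kernel_of s s.
Proof. by []. Qed.

Lemma kernel_of_eq N s : kernels S N -> N s -> N = kernel_of s.
Proof.
case=> r _ <- rs; rewrite /kernel_of; apply/seteqP.
by split=> t /=; rewrite (rs : C2 [set r] = _).
Qed.

(** One commuting pair suffices for each pair of kernels: a kernel containing [s] lies in [C2
    [set s]], so [commuting_C2] spreads the relation to all elements. *)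
Lemma commutative_kernels (M : set (set S)) :
  (forall N, M N -> kernels S N) ->
  (forall N N', M N -> M N' ->
     exists s t, [/\ N s, N' t & commuting s t]) ->
  commutative_set (\bigcup_(N in M) N).
Proof.
move=> Mk Mc x y [N MN Nx] [N' MN' N'y].
have [s [t [Ns N't st]]] := Mc _ _ MN MN'.
apply: (commuting_C2 st).
  by rewrite -(Cel_kernel (Mk _ MN) Ns) (Cel_kernel (Mk _ MN) Nx); exact: C2_self.
by rewrite -(Cel_kernel (Mk _ MN') N't) (Cel_kernel (Mk _ MN') N'y); exact: C2_self.
Qed.

(** Distinct kernels are disjoint, so only the summand at the kernel of [s] can contain [s]. *)
Lemma fpow_in_fsum_kernels (X : set S -> fpow S) s :
  (forall N, kernels S N -> fin_subsets N (X N)) ->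
  finite_set [set N | kernels S N /\ X N <> 0] ->
  fpow_in s (\sum_(N \in kernels S) X N) = fpow_in s (X (kernel_of s)).
Proof.
(* Restricting to the finite support turns the sum into one over a finite sequence. *)
move=> XN finX; rewrite -(fsbig_widen [set N | kernels S N /\ X N <> 0]); last 2 first.
- by move=> N [].
- move=> N [/= kN nX]; apply: contrapT => XN0; exact: nX.
rewrite (fsbig_finite _ _ finX) /= fpow_in_sum.
have off N : kernels S N -> N != kernel_of s -> fpow_in s (X N) = false.
  move=> kN /eqP neq; apply/negP => sX; apply: neq.
  by apply: kernel_of_eq => //; exact: XN sX.
(* If this summand vanishes, its kernel is absent from the sequence and no term contains [s];
   otherwise it is the term to split off. *)
have [X0|X0] := pselect (X (kernel_of s) = 0).
  rewrite big_seq big1 ?X0 ?fpow_in0 // => N.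
  rewrite in_fset_set // inE => -[kN nX]; apply: off => //.
  by apply/eqP => NE; apply: nX; rewrite NE.
rewrite (bigD1_seq (kernel_of s)) ?fset_uniq //=; last first.
  by rewrite in_fset_set // inE; split=> //; exact: kernels_kernel_of.
rewrite big_seq_cond big1 ?addbF // => N /andP[].
by rewrite in_fset_set // inE => -[kN _]; exact: off.
Qed.

(** Every element of the sum lies in some [Y x], hence in [C2 [set x]], and the indices [x] commute
    pairwise. It serves both for images and for preimages of singletons. *)
Lemma fin_commutative_sum (X : fpow S) (Y : S -> fpow S) :
  fin_commutative S X ->
  (forall x, fpow_in x X -> fin_subsets (C2 [set x]) (Y x)) ->
  fin_commutative S (\sum_(x <- (X : {fset S})) Y x).
Proof.
move=> cX XY y y' /fpow_in_sum_exists [x xX yx] /fpow_in_sum_exists [x' x'X y'x'].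
by apply: (commuting_C2 (cX x x' xX x'X)); [exact: XY yx|exact: XY y'x'].
Qed.

Lemma fin_commutative_decomp (x : fpow S) :
  fin_commutative S x <-> exists X : set S -> fpow S,
    [/\ forall N, kernels S N -> fin_subsets N (X N),
        finite_set [set N | kernels S N /\ X N <> 0],
        commutative_set (\bigcup_(N in [set N | kernels S N /\ X N <> 0]) N)
      & x = \sum_(N \in kernels S) X N].
Proof.
split=> [cx|[X [XN finX cX ->]] s t /=]; last first.
  have ins u : fpow_in u (\sum_(N \in kernels S) X N) ->
      (\bigcup_(N in [set N | kernels S N /\ X N <> 0]) N) u.
    rewrite fpow_in_fsum_kernels // => uX; exists (kernel_of u) => //.
    split; first exact: kernels_kernel_of.
    by move=> X0; move: uX; rewrite X0 fpow_in0.
  by move=> /ins us /ins ut; exact: cX.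
(* The component at [N] is the intersection of [x] with [N]. *)
have [X XE] := choice (fpow_restrict_exists x).
have Xne N : kernels S N -> X N <> 0 -> exists2 s, N s & fpow_in s x.
  move=> kN XN0; apply: contrapT => nos; apply: XN0; apply: fpowP => s.
  rewrite XE fpow_in0; apply/negP => /andP[sx]; rewrite inE => Ns.
  by apply: nos; exists s.
have XN N : kernels S N -> fin_subsets N (X N).
  by move=> _ s /=; rewrite XE => /andP[_]; rewrite inE.
have finX : finite_set [set N | kernels S N /\ X N <> 0].
  (* Each kernel in the support meets [x], so the support lies in the image of the finite set [x]
     under [kernel_of]. *)
  apply: (@sub_finite_set _ _ (@kernel_of W S @` [set` (x : {fset S})])).
    move=> N [kN] /(Xne _ kN)[s Ns sx]; exists s => //.
    by rewrite -(kernel_of_eq kN Ns).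
  by apply: finite_image; exact: finite_fset.
exists X; split=> //.
- apply: commutative_kernels => [N []//|N N' [kN /(Xne _ kN)[s Ns sx]]].
  move=> [kN' /(Xne _ kN')[t N't tx]]; exists s, t; split=> //; exact: cx.
- apply: fpowP => s; rewrite fpow_in_fsum_kernels // XE.
  by rewrite (mem_set (@kernel_of_self s)) andbT.
Qed.

(** * Fixed kernels and stable cells *)

Lemma fin_subsets_inj : injective (@fin_subsets W S).
Proof.
suff sub T T' : fin_subsets T = fin_subsets T' -> T `<=` T'.
  by move=> T T' TT'; apply/seteqP; split; apply: sub.
move=> TT' s Ts.
have : fin_subsets T ([fset s]%fset : fpow S).
  by move=> t /=; rewrite fpow_in_fset1 => /eqP ->.
by rewrite TT'; apply; rewrite /= fpow_in_fset1.
Qed.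

Lemma Cel_inj N N' : kernels S N -> kernels S N' -> Cel N = Cel N' -> N = N'.
Proof.
move=> [s _ <-] [t _ <-].
rewrite (Cel_kernel (kernels_kernel_of s) (@kernel_of_self s)).
rewrite (Cel_kernel (kernels_kernel_of t) (@kernel_of_self t)) => st.
by rewrite /kernel_of st.
Qed.

Lemma perm_kernels_id (phi : fpow S -> fpow S) N : kernels S N ->
  perm_kernels phi N = N <->
  phi @` fin_subsets (Cel N) = fin_subsets (Cel N).
Proof.
move=> kN; rewrite /perm_kernels; split=> [|phiN].
  case: xgetP => [N' _ [_ phiN] NN'|_ N0]; first by move: phiN; rewrite NN'.
  (* The default value [set0] cannot equal [N], as kernels are nonempty. *)
  by case: kN; rewrite -N0 => s _ s0; have := @kernel_of_self s; rewrite s0.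
apply: xget_unique => // N' [kN' phiN'].
by apply: Cel_inj => //; apply: fin_subsets_inj; rewrite -phiN.
Qed.

(** The image of a commutative [X] is the sum of the images of its singletons, each inside its own
    cell. The reverse inclusion is the same argument with preimages. *)
Lemma cell_stable_fin_commutative (phi : {linear fpow S -> fpow S}) :
  (forall T, cells S T -> phi @` fin_subsets T = fin_subsets T) ->
  phi @` fin_commutative S = fin_commutative S.
Proof.
move=> phiT.
have sing x : fin_subsets (C2 [set x]) ([fset x]%fset : fpow S).
  by move=> t /=; rewrite fpow_in_fset1 => /eqP ->; exact: C2_self.
have phiC x : phi @` fin_subsets (C2 [set x]) = fin_subsets (C2 [set x]).
  by apply: phiT; exists x.
apply/seteqP; split=> [_ [X cX <-]|X cX].
  rewrite [X in phi X]fpow_sum_singletons linear_sum.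
  by apply: fin_commutative_sum => // x _; rewrite -phiC; exists [fset x]%fset.
(* As [phi] maps the subspace of each cell onto itself, a preimage of the singleton of [x] can be
   chosen within [C2 [set x]]. *)
have /choice [Y YE] (x : S) : exists Yx : fpow S,
    fin_subsets (C2 [set x]) Yx /\ phi Yx = ([fset x]%fset : fpow S).
  by move: (sing x); rewrite -{1}phiC => -[Yx YxT YxE]; exists Yx.
exists (\sum_(x <- (X : {fset S})) Y x).
  by apply: fin_commutative_sum => // x _; case: (YE x).
rewrite linear_sum [RHS]fpow_sum_singletons.
by apply: eq_bigr => x _; case: (YE x).
Qed.

End Cells.

Theorem proposition10 (W : groupType) (S : set W) (Gamma : S -> S -> nat)
    (WS : right_angled_coxeter Gamma) :
  fin_commutative S =
    [set x : fpow S | exists X : set S -> fpow S,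
      [/\ forall N, kernels S N -> fin_subsets N (X N),
          finite_set [set N | kernels S N /\ X N <> 0],
          commutative_set (\bigcup_(N in [set N | kernels S N /\ X N <> 0]) N)
        & x = \sum_(N \in kernels S) X N]]
  /\
  KGamma S =
    [set phi | Aut S phi /\
      forall T, cells S T -> phi @` fin_subsets T = fin_subsets T].
Proof.
split; first by apply/seteqP; split=> x /fin_commutative_decomp.
(* The cells are exactly the sets [Cel N], so by [perm_kernels_id] fixing every kernel amounts to
   stabilizing every cell; the converse inclusion must also recover the stability of
   [fin_commutative S]. *)
apply/seteqP; split=> [phi [[phiA _] phiN]|phi [phiA phiT]].
  split=> // _ [s _ <-].
  have ks := kernels_kernel_of s.
  rewrite -(Cel_kernel ks (@kernel_of_self _ _ s)).
  by apply/perm_kernels_id => //; exact: phiN.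
split=> [|N kN]; first by split=> //; exact: cell_stable_fin_commutative.
apply/perm_kernels_id => //; apply: phiT.
by case: (kN) => s _ sN; exists s => //; rewrite (@Cel_kernel _ _ _ s kN) // -sN.
Qed.
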